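(* Let $D$ be a (strongly) 2-connected semi-complete noneven digraph. Then $D = W_4$ (up to isomorphism).
   Context: Digraphs are finite, without loops and without parallel arcs (both arcs $(u,v)$ and $(v,u)$ may be present). A digraph is strong if for every ordered pair of vertices $(u,v)$ there is a directed path from $u$ to $v$. A digraph is strongly 2-connected (2-connected for short) if it has at least 3 vertices and the removal of at most one vertex always leaves a strong digraph. A digraph is semi-complete if for each pair of distinct vertices $u,v$ at least one of the arcs $(u,v)$, $(v,u)$ is present. A digraph $D$ is noneven if one can assign a weight in $\{0,1\}$ to each arc so that no directed (simple) cycle of $D$, including cycles of length 2, has even total weight. $W_4$ is the digraph on vertices $1,2,3,4$ with the eight arcs $(1,2),(2,3),(3,4),(4,1),(1,3),(3,1),(2,4),(4,2)$; up to isomorphism it is the only semi-complete digraph on four vertices in which every vertex has indegree and outdegree two. *)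

(* Defs.v *)
From mathcomp Require Import all_boot.

Set Implicit Arguments.
Unset Strict Implicit.
Unset Printing Implicit Defensive.

(* Since arcs form a relation, parallel arcs are excluded, while both (u, v)
   and (v, u) may be arcs. *)
Record digraph := Digraph {
  vertex :> finType;
  arc : rel vertex;
  arc_irrefl : irreflexive arc
}.

Section Digraphs.
Variable D : digraph.

Definition strong : Prop := forall u v : D, connect (@arc D) u v.

Section Delete.
Variable S : {set D}.

Definition del_arc : rel {x : D | x \notin S} := fun x y => arc (val x) (val y).

Lemma del_arc_irrefl : irreflexive del_arc.
Proof. by move=> x; apply: arc_irrefl. Qed.

Definition del : digraph := Digraph del_arc_irrefl.
End Delete.

Definition semicomplete : Prop :=
  forall u v : D, u != v -> arc u v || arc v u.

(* A directed simple cycle is a nonempty duplicate-free sequence of vertices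
   satisfying [cycle arc]; singletons are ruled out by [arc_irrefl], and
   [:: u; v] with both arcs present is a cycle of length 2. *)
Definition dicycle (c : seq D) : bool := (c != [::]) && ucycleb (@arc D) c.

Definition cycle_weight (w : D -> D -> bool) (c : seq D) : nat :=
  \sum_(x <- c) w x (next c x).

(* The values of w on pairs that are not arcs are never used. *)
Definition noneven : Prop :=
  exists w : D -> D -> bool,
    forall c : seq D, dicycle c -> odd (cycle_weight w c).
End Digraphs.

Definition two_connected (D : digraph) : Prop :=
  3 <= #|D| /\ forall S : {set D}, #|S| <= 1 -> strong (del S).

Definition isomorphic (D E : digraph) : Prop :=
  exists2 f : D -> E, bijective f & forall u v : D, arc (f u) (f v) = arc u v.

(* Vertices are numbered from 0, i.e. shifted by one from 1, 2, 3, 4. *)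
Definition W4_arc : rel 'I_4 := fun u v =>
  (u : nat, v : nat) \in
    [:: (0, 1); (1, 2); (2, 3); (3, 0); (0, 2); (2, 0); (1, 3); (3, 1)].

Lemma W4_arc_irrefl : irreflexive W4_arc.
Proof. by move=> [[|[|[|[|m]]]] lt_m]. Qed.

Definition W4 : digraph := Digraph W4_arc_irrefl.

(* Main.v *)
Require Import Defs.
From mathcomp Require Import all_boot.
From mathcomp Require Import zify.

(** The proof is a descent on the number of vertices by contraction. For an arc
    [u -> v], delete [u] and redirect to [v] the arcs that entered [u]. This keeps the
    digraph semicomplete, and it keeps it noneven: a cycle through a redirected arc
    becomes a cycle of the original digraph when [u] is reinserted before [v], and the
    redirected arc carries the weight of the path through [u]
    ([contract_odd_cycles]).

    What may be lost is 2-connectivity. In a semicomplete digraph the strong components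
    are linearly ordered, and comparing the initial components that appear when [u] and
    a second vertex are deleted shows that some out-neighbour [v] of [u] can be used
    for a contraction, unless [u] dominates a vertex [x] of indegree two such that
    deleting [u] and [x] destroys strength ([contract_or_indegree2]). Reversing all arcs
    gives the dual statement, about vertices of outdegree two.

    If no contraction is possible at any vertex, in either direction, then the vertices
    of indegree two and those of outdegree two are each at least half of all vertices.
    When there are six or more, no vertex is of both kinds, the two kinds partition the
    digraph, and its arcs are so restricted that deleting some such pair [u], [x] cannot
    destroy strength ([indegree2_card]). So a 2-connected semicomplete noneven
    digraph with at least six vertices yields one with one vertex less, and it
    suffices to exclude five vertices.

    Orders three, four and five are settled by an exhaustive search over weighted
    semicomplete digraphs, pruned as soon as an even cycle appears, with weights
    normalised at one vertex by switching ([small_search345]). The only 2-connected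
    survivors are the copies of [W4] ([small_order]). *)

Set Implicit Arguments.
Unset Strict Implicit.
Unset Printing Implicit Defensive.

(** * Parity of weighted walks *)

Section Parity.
Variable T : eqType.
Implicit Types (w : T -> T -> bool) (p q : seq T).

(** The parity of a walk is kept additive in [bool], rather than as the parity of
    a sum in [nat], so that splitting, rotating and reversing walks are
    identities of [addb]. *)
Fixpoint parity w x p :=
  if p is y :: q then w x y (+) parity w y q else false.

Lemma parity_cat w x p q :
  parity w x (p ++ q) = parity w x p (+) parity w (last x p) q.
Proof. by elim: p x => //= y p IHp x; rewrite IHp addbA. Qed.

Lemma parity_rot w x y p q :
  parity w x (rcons (p ++ y :: q) x) = parity w y (rcons (q ++ x :: p) y).
Proof.
rewrite !rcons_cat /= -!cat_rcons !parity_cat !last_rcons.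
by rewrite addbC.
Qed.

Lemma parity_rev w x y p :
  parity w x (rcons p y) = parity (fun a b => w b a) y (rcons (rev p) x).
Proof.
elim: p x => [|z p IHp] x //=.
by rewrite rev_cons -[rcons (rcons _ _) _]cats1 parity_cat last_rcons /= addbF
  IHp addbC.
Qed.

(** Switching at a set of vertices, with indicator [s], flips every arc with
    exactly one end in the set; along a walk the flips telescope, so closed
    walks keep their parity. *)
Lemma parity_switch w (s : T -> bool) x p :
  parity (fun a b => w a b (+) (s a (+) s b)) x p =
  parity w x p (+) (s x (+) s (last x p)).
Proof.
elim: p x => [|y p IHp] x /=; first by rewrite addbb.
by rewrite IHp; move: (w x y) (parity w y p) (s x) (s y) (s (last y p)) => [] [] [] [] [].
Qed.

End Parity.

Lemma cycle_weight_parity (D : digraph) (w : D -> D -> bool) x p :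
  uniq (x :: p) -> odd (cycle_weight w (x :: p)) = parity w x (rcons p x).
Proof.
move=> Up; rewrite /cycle_weight.
have -> : parity w x (rcons p x) = odd (\sum_(b <- pairmap w x (rcons p x)) b).
  elim: (rcons p x) {1 3}x => [|z q IHq] y /=; first by rewrite big_nil.
  by rewrite big_cons oddD -IHq oddb.
suff -> : pairmap w x (rcons p x) = [seq w y (next (x :: p) y) | y <- x :: p].
  by rewrite big_map.
apply: (@eq_from_nth _ false) => [|i].
  by rewrite size_pairmap size_rcons size_map.
rewrite size_pairmap size_rcons => lti.
rewrite (nth_pairmap x) ?size_rcons // (nth_map x) // next_nth mem_nth //.
rewrite index_uniq // nth_rcons -rcons_cons nth_rcons /= lti.
by rewrite if_same; case: ltnP => // le_p_i; rewrite [in RHS](nth_default x le_p_i).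
Qed.

(** * Source sets and strong connectivity *)

Section Local.
Variable T : finType.
Implicit Types (e : rel T) (A S V : {set T}).

Definition semicomplete_on e A :=
  {in A &, forall x y, x != y -> e x y || e y x}.

(** Words of length one are excluded because contraction, defined below, puts a
    loop at a vertex that was joined to the contracted one in both directions. *)
Definition odd_cycles e (w : T -> T -> bool) A := forall x p,
  p != [::] -> uniq (x :: p) -> {subset x :: p <= A} ->
  path e x (rcons p x) -> parity w x (rcons p x).

Definition source_set e V S :=
  [&& S \subset V, S != set0, S != V &
      [forall x in V :\: S, forall y in S, ~~ e x y]].

(** Strong connectivity in cut form: some arc enters every nonempty proper subset
    of [V]. Failure of strength then comes with a source set to work with. *)
Definition strong_on e V := forall S, ~~ source_set e V S.

(** Strength of [A] itself is implied as soon as [A] has three vertices. *)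
Definition two_connected_on e A := {in A, forall x, strong_on e (A :\ x)}.

Definition rev_rel (R : Type) (f : T -> T -> R) x y := f y x.

Lemma source_setP e V S :
  reflect [/\ S \subset V, S != set0, exists2 x, x \in V & x \notin S &
              forall x y, x \in V -> x \notin S -> y \in S -> ~~ e x y]
          (source_set e V S).
Proof.
apply: (iffP and4P) => [[SV S0 SnV /forall_inP noe]|[SV S0 [x xV xS] noe]].
  split=> // [|x y xV xS].
    by apply/exists_inP; apply: contraR SnV => /exists_inPn VS;
      rewrite eqEsubset SV; apply/subsetP=> x /VS; rewrite negbK.
by have := noe x; rewrite inE xS xV => /(_ isT) /forall_inP noex /noex.
split=> //; first by apply: contraNneq xS => ->.
by apply/forall_inP=> a /setDP[aV aS]; apply/forall_inP=> b bS; apply: noe.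
Qed.

Lemma strong_on_arc e V S : strong_on e V -> S \subset V -> S != set0 ->
  (exists2 x, x \in V & x \notin S) ->
  exists x y, [/\ x \in V, x \notin S, y \in S & e x y].
Proof.
move=> /(_ S) sV SV S0 SV'.
have /exists_inP[x /setDP[xV xS] /exists_inP[y yS xy]] :
    [exists x in V :\: S, exists y in S, e x y].
  apply: contraR sV => /exists_inPn noe; apply/source_setP; split=> // x y xV xS.
  by have := noe x; rewrite inE xV xS => /(_ isT) /exists_inPn noex /noex.
by exists x, y.
Qed.

Lemma strong_on_rev e V : strong_on e V -> strong_on (rev_rel e) V.
Proof.
move=> sV S; apply/negP=> /source_setP[SV /set0Pn[y yS] [x xV xS] noe].
have [||a [b [aV]]] := strong_on_arc sV (subsetDl V S).
- by apply/set0Pn; exists x; apply/setDP.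
- by exists y; rewrite ?(subsetP SV) // inE yS.
rewrite inE aV andbT negbK => aS /setDP[bV bS] ab.
by have := noe b a bV bS aS; rewrite /rev_rel ab.
Qed.

Lemma two_connected_on_rev e A :
  two_connected_on e A -> two_connected_on (rev_rel e) A.
Proof. by move=> cA x xA; apply/strong_on_rev/cA. Qed.

Lemma semicomplete_on_rev e A :
  semicomplete_on e A -> semicomplete_on (rev_rel e) A.
Proof. by move=> sA x y xA yA xy; rewrite /rev_rel orbC sA. Qed.

Lemma odd_cycles_rev e (w : T -> T -> bool) A :
  odd_cycles e w A -> odd_cycles (rev_rel e) (rev_rel w) A.
Proof.
move=> oA x p p0 Up pA pe; rewrite parity_rev.
have Erev q : rcons (rev q) x = rev (belast x (rcons q x)).
  by rewrite belast_rcons rev_cons.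
apply: oA; last by have := rev_path e x (rcons p x); rewrite last_rcons -Erev => ->.
- by rewrite -size_eq0 size_rev size_eq0.
- by rewrite /= mem_rev rev_uniq.
- by move=> y; rewrite inE mem_rev -in_cons; apply: pA.
Qed.

(** * Contraction *)

Section Contraction.
Variables (e : rel T) (w : T -> T -> bool) (u v : T).

(** Contraction of the arc [u -> v] on vertices other than [u]: the other arcs
    leaving [u] are dropped, and an arc entering [u] is redirected to [v]. *)
Definition contract_arc : rel T :=
  fun x y => e x y || (y == v) && e x u.

(** A redirected arc stands for the path through [u], and gets its weight. *)
Definition contract_weight x y :=
  if (y == v) && e x u then w x u (+) w u v else w x y.

Hypotheses (uv : e u v) (neq_vu : v != u).

Lemma contract_semicomplete A :
  semicomplete_on e A -> semicomplete_on contract_arc (A :\ u).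
Proof.
move=> sA x y /setD1P[_ xA] /setD1P[_ yA] /(sA _ _ xA yA).
by rewrite /contract_arc => /orP[->|->]; rewrite ?orbT.
Qed.

Lemma contract_off x p : v \notin p ->
  path contract_arc x p = path e x p
  /\ parity contract_weight x p = parity w x p.
Proof.
elim: p x => //= y p IHp x; rewrite inE negb_or eq_sym => /andP[yv yp].
by have [-> ->] := IHp y yp; rewrite /contract_arc /contract_weight (negPf yv) orbF.
Qed.

(** A cycle through [v] enters it by one arc. If that arc was redirected,
    reinserting [u] before [v] gives a cycle of the original digraph with the same
    weight; otherwise the cycle and its weight are unchanged. *)
Lemma contract_odd_cycle_at A p : v \notin p -> uniq p -> p != [::] ->
  u \in A -> {subset v :: p <= A :\ u} -> odd_cycles e w A ->
  path contract_arc v (rcons p v) -> parity contract_weight v (rcons p v).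
Proof.
case/lastP: p => // p x vp Up _ uA pA oA.
have [pathp parp] := contract_off v vp.
rewrite -[rcons (rcons _ _) _]cats1 cat_path parity_cat pathp parp last_rcons /=.
rewrite /contract_arc /contract_weight eqxx /= andbT addbF.
have [up vA] : u \notin rcons p x /\ v \in A.
  split; first by apply/negP=> up; have := pA u; rewrite !inE up eqxx orbT => /(_ isT).
  by have := pA v; rewrite !inE eqxx neq_vu => /(_ isT).
have subA : {subset v :: rcons p x <= A} by move=> y /pA /setD1P[].
have [xu|_] := boolP (e x u); rewrite ?orbT ?orbF /= => /andP[pe xv].
  have := oA v (rcons (rcons p x) u); rewrite -[rcons (rcons _ u) v]cats1.
  rewrite cat_path parity_cat !last_rcons -cats1 cat_path parity_cat !last_rcons /=.
  rewrite pe xu uv !addbF addbA; apply=> //.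
  - by case: (p).
  - by rewrite cats1 rcons_uniq mem_rcons inE negb_or neq_vu up Up vp.
  - move=> y; rewrite cats1 inE mem_rcons inE orbCA => /orP[/eqP-> //|].
    by rewrite -in_cons; apply: subA.
have := oA v (rcons p x); rewrite -[rcons (rcons _ _) _]cats1.
rewrite cat_path parity_cat !last_rcons /= pe xv addbF; apply=> //.
  by case: (p).
by rewrite /= vp.
Qed.

Lemma contract_odd_cycles A :
  u \in A -> odd_cycles e w A -> odd_cycles contract_arc contract_weight (A :\ u).
Proof.
move=> uA oA x p p0 Up pA.
have [vp|vp] := boolP (v \in x :: p); last first.
  have [-> ->] : path contract_arc x (rcons p x) = path e x (rcons p x) /\
    parity contract_weight x (rcons p x) = parity w x (rcons p x).
    by apply: contract_off; rewrite mem_rcons.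
  by apply: oA => // y /pA /setD1P[].
move: vp; rewrite inE => /predU1P[Dv|vp]; first subst x.
  by case/andP: Up => vp Up; apply: contract_odd_cycle_at vp Up p0 uA pA oA.
case/splitPr: vp p0 Up pA => p1 p2 _ Up pA.
(* The cycle is restarted at [v], where the previous lemma applies. *)
have [vp Uq subq] : [/\ v \notin p2 ++ x :: p1, uniq (p2 ++ x :: p1) &
    {subset v :: p2 ++ x :: p1 <= A :\ u}].
  have Dp : perm_eq (x :: p1 ++ v :: p2) (v :: p2 ++ x :: p1).
    by rewrite -cat_cons perm_catC.
  move: Up; rewrite (perm_uniq Dp) /= => /andP[? ?]; split=> // y.
  by rewrite -(perm_mem Dp); apply: pA.
rewrite parity_rot => pe; apply: (contract_odd_cycle_at vp Uq _ uA subq oA).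
  by case: (p2).
by move: pe; rewrite !rcons_cat /= -!cat_rcons !cat_path !last_rcons andbC.
Qed.
End Contraction.

(** * Contractions that keep 2-connectivity *)

Definition in_nbrs e A x := [set y in A :\ x | e y x].

Section GoodContraction.
Variables (e : rel T) (A : {set T}) (u : T).
Hypotheses (scA : semicomplete_on e A) (cA : two_connected_on e A) (uA : u \in A).
Hypothesis A_gt2 : 2 < #|A|.
Let H := A :\ u.

Let stH : strong_on e H. Proof. exact: cA. Qed.

(** Deleting [w] alone leaves a strong digraph, so whatever breaks when [u] is
    deleted as well was held together by an arc of [u]. *)
Lemma source_set_out (w : T) S : w \in H -> source_set e (H :\ w) S ->
  exists2 v, v \in S & e u v.
Proof.
move=> /setD1P[wu wA] /source_setP[SH S0 [x xH xS] noe].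
have uS : u \notin S by apply/negP=> /(subsetP SH); rewrite !inE eqxx andbF.
have [|//||a [v [/setD1P[aw aA] aS vS av]]] := strong_on_arc (cA wA) (S := S).
- by apply: subset_trans SH _; apply: setSD; apply: subsetDl.
- by exists u => //; rewrite !inE eq_sym wu.
exists v => //; have [<- //|au] := eqVneq a u.
by have := noe a v; rewrite !inE aw au aA => /(_ isT aS vS); rewrite av.
Qed.

Lemma source_set_in (w : T) S : w \in H -> source_set e (H :\ w) S ->
  exists2 x, x \in (H :\ w) :\: S & e x u.
Proof.
move=> /setD1P[wu wA] /source_setP[SH S0 [x xH xS] noe].
have [|||a [b [/setD1P[aw aA] aS]]] := strong_on_arc (cA wA) (S := u |: S).
- apply/subsetP=> y; rewrite !inE => /predU1P[->|]; first by rewrite eq_sym wu.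
  by move/(subsetP SH); rewrite !inE => /and3P[-> _ ->].
- by apply/set0Pn; exists u; rewrite setU11.
- move: xH; rewrite !inE => /and3P[xw xu xA].
  by exists x; rewrite !inE ?xw // negb_or xu.
move: aS; rewrite !inE negb_or => /andP[au aS] /predU1P[->|bS ab].
  by exists a; rewrite // !inE aS aw au.
by have := noe a b; rewrite !inE aw au aA => /(_ isT aS bS); rewrite ab.
Qed.

(** A set that stays a source set after contraction was one before, so it contains
    [v] by hypothesis; but [u] had an in-neighbour outside it, whose arc is
    redirected to [v]. *)
Lemma contract_two_connected v : e u v -> v \in H ->
    (forall (w : T) S, w \in H -> source_set e (H :\ w) S -> (v != w) && (v \in S)) ->
  two_connected_on (contract_arc e u v) H.
Proof.
move=> uv vH good w wH S; apply/negP=> srcS.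
have srcS' : source_set e (H :\ w) S.
  have [SH S0 Sn noe] := source_setP _ _ _ srcS.
  apply/source_setP; split=> // x y xH xS yS.
  by apply: contra (noe x y xH xS yS) => xy; rewrite /contract_arc xy.
have /andP[vw vS] := good w S wH srcS'.
have [x /setDP[xH xS] xu] := source_set_in wH srcS'.
have [_ _ _ noe] := source_setP _ _ _ srcS.
by have := noe x v xH xS vS; rewrite /contract_arc eqxx xu orbT.
Qed.

(** The source sets that appear after deleting [u] and some [w] are almost nested,
    because in a semicomplete digraph two crossing source sets would leave a pair of
    vertices with no arc. So an out-neighbour [v] of [u] in a smallest one, [S], lies
    in all of them, unless two different deleted vertices [w] and [w'] interfere:
    [S] is [[set w']], or the source set for [w'] is [[set w]]. In both cases the single
    vertex has no in-neighbours but [u] and one of [w], [w'], and deleting it together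
    with [u] destroys strength. *)
Lemma contract_or_indegree2 :
  (exists2 v, v \in H & e u v /\ two_connected_on (contract_arc e u v) H) \/
  exists2 x, x \in H & [/\ e u x, #|in_nbrs e A x| <= 2 &
                         ~ strong_on e (H :\ x)].
Proof.
pose P := [pred wS : T * {set T} | (wS.1 \in H) && source_set e (H :\ wS.1) wS.2].
have [[w0 S0] P0|noP] := pickP P; last first.
  have [w wH] : exists w, w \in H.
    by apply/set0Pn; rewrite -card_gt0; move: A_gt2; rewrite (cardsD1 u) uA; case: #|_|.
  have [v vHw uv] : exists2 v, v \in H :\ w & e u v.
    have /setD1P[wu wA] := wH.
    have [|||x [v [/setD1P[xw xA] xH vH xv]]] := strong_on_arc (cA wA) (S := H :\ w).
    - by apply: setSD; apply: subsetDl.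
    - rewrite -card_gt0; move: A_gt2; rewrite (cardsD1 u) uA (cardsD1 w) wH.
      by case: #|_|.
    - by exists u; rewrite !inE ?eqxx ?andbF // eq_sym wu.
    exists v => //; suff <- : x = u by [].
    by apply/eqP; apply: contraR xH => xu; rewrite !inE xw xu.
  have vH : v \in H by case/setD1P: vHw.
  left; exists v => //; split=> //; apply: contract_two_connected => // w' S w'H srcS.
  by have := noP (w', S); rewrite /= w'H srcS.
have [[w S] /= /andP[wH srcS] minS] := arg_minnP (fun wS : T * {set T} => #|wS.2|) P0.
have [v vS uv] := source_set_out wH srcS.
have [SH _ [r rH rS] noS] := source_setP _ _ _ srcS.
have vH : v \in H by have := subsetP SH v vS; rewrite inE => /andP[].
have [good|] := boolP [forall w', forall S', 
   P (w', S') ==> (v != w') && (v \in S')].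
  left; exists v => //; split=> //; apply: contract_two_connected => // w' S' w'H srcS'.
  by have /forallP/(_ w')/forallP/(_ S') := good; rewrite /= w'H srcS'.
rewrite negb_forall => /existsP[w']; rewrite negb_forall => /existsP[S'].
rewrite negb_imply /= => /andP[/andP[w'H srcS'] bad]; right.
have leS S1 w1 : w1 \in H -> source_set e (H :\ w1) S1 -> #|S| <= #|S1|.
  by move=> w1H src1; apply: (minS (w1, S1)); rewrite /= w1H.
have [S'H _ [r' r'H r'S'] noS'] := source_setP _ _ _ srcS'.
have SinH a : a \in S -> a != w /\ a \in H by move/(subsetP SH)/setD1P.
have S'inH a : a \in S' -> a != w' /\ a \in H by move/(subsetP S'H)/setD1P.
have{noS} noS a b : a \in H -> a != w -> a \notin S -> b \in S -> ~~ e a b.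
  by move=> aH aw; apply: noS; apply/setD1P.
have{noS'} noS' a b : a \in H -> a != w' -> a \notin S' -> b \in S' -> ~~ e a b.
  by move=> aH aw; apply: noS'; apply/setD1P.
have /setD1P[rw {}rH] := rH; have /setD1P[r'w' {}r'H] := r'H.
have conclude x z S'' : e u x -> x \in H -> source_set e (H :\ x) S'' ->
    (forall y, y \in H -> y != x -> y != z -> ~~ e y x) ->
    exists2 x, x \in H & [/\ e u x, #|in_nbrs e A x| <= 2 &
                         ~ strong_on e (H :\ x)].
  move=> ux xH srcx nox; exists x => //; split=> // [|/(_ S'')]; last by rewrite srcx.
  apply: leq_trans (_ : #|[set u; z]| <= 2); last by rewrite cards2; case: eqP.
  apply/subset_leq_card/subsetP=> y; rewrite !inE => /andP[/andP[yx yA] eyx].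
  apply: contraLR eyx; rewrite negb_or => /andP[yu yz].
  by apply: nox; rewrite // !inE yu.
have cross a b : a \in S -> a \notin S' -> a != w' ->
                 b \in S' -> b \notin S -> b != w -> False.
  move=> aS aS' aw' bS' bS bw.
  have [[_ aH] [_ bH]] := (SinH _ aS, S'inH _ bS').
  have neq_ab : a != b by apply: contraNneq bS => <-.
  have /orP[] : e a b || e b a.
    by move: aH bH neq_ab => /setD1P[_ aA] /setD1P[_ bA]; apply: scA.
  - by apply/negP; apply: noS'.
  - by apply/negP; apply: noS.
have no_source S1 x1 y1 : x1 \in S1 -> y1 \in H -> y1 \notin S1 -> S1 \subset H ->
    ~ (forall a b, a \in H -> a \notin S1 -> b \in S1 -> ~~ e a b).
  move=> x1S y1H y1S S1H no1; case/negP: (stH S1); apply/source_setP; split=> //.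
    by apply/set0Pn; exists x1.
  by exists y1.
(* For the same deleted vertex the source sets form a chain. *)
have [Dw'|neq_w'w] := eqVneq w' w.
  subst w'; case/negP: bad; have [-> _] := SinH v vS; apply: contraT => vS'.
  have /subsetPn[b bS' bS] : ~~ (S' \subset S).
    apply: contra vS' => S'S.
    by have /eqP-> : S' == S by rewrite eqEcard S'S (leS _ _ w'H srcS').
  by case: (cross v b) => //; [case: (SinH v vS) | case: (S'inH b bS')].
(* By [cross], either [S'] is contained in [w |: S] or [S] in [w' |: S']. *)
have [/exists_inP[a aS /andP[aS' aw']]|/exists_inPn SR'] :=
    boolP [exists a in S, (a \notin S') && (a != w')].
  have RS' b : b \in S' -> (b == w) || (b \in S).
    move=> bS'; apply: contraT; rewrite negb_or => /andP[bw bS].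
    by case: (cross a b).
  have [wS'|wS'] := boolP (w \in S'); last first.
    have S'S : S' \subset S.
      by apply/subsetP=> b bS'; have /predU1P[Db|//] := RS' b bS'; rewrite -Db bS' in wS'.
    have DS : S' = S by apply/eqP; rewrite eqEcard S'S (leS _ _ w'H srcS').
    by rewrite DS aS in aS'.
  (* If [w'] is in [S], then [w |: S] is a source set of [H], which is strong. *)
  have [w'S|w'S] := boolP (w' \in S).
    case: (no_source (w |: S) w r); rewrite ?setU11 // ?inE ?negb_or ?rw //.
      by apply/subsetP=> y /setU1P[->//|/SinH[]].
    move=> x y xH; rewrite !inE negb_or => /andP[xw xS] /predU1P[->|]; last exact: noS.
    apply: noS' => //; first by apply: contraNneq xS => ->.
    by apply/negP=> /RS'; rewrite (negPf xw) (negPf xS).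
  have SS0 : S :&: S' = set0.
    apply/eqP; apply: contraNT aS' => SS'; apply: (subsetP _ a aS).
    suff /(leS _ _ wH) le : source_set e (H :\ w) (S :&: S').
      have /eqP <- : S :&: S' == S by rewrite eqEcard subsetIl le.
      exact: subsetIr.
    apply/source_setP; split=> //.
    - exact: subset_trans (subsetIl _ _) SH.
    - by exists r; [apply/setD1P | rewrite inE (negPf rS)].
    move=> x y /setD1P[xw xH]; rewrite !inE => xSS' /andP[yS yS'].
    have [xS|xS] := boolP (x \in S); last exact: noS.
    apply: noS' => //; first by apply: contraNneq w'S => <-.
    by rewrite xS in xSS'.
  have S'w y : y \in S' -> y = w.
    move=> yS'; have /predU1P[//|yS] := RS' y yS'.
    by have := in_set0 y; rewrite -SS0 inE yS yS'.
  have [v' /S'w -> uw] := source_set_out w'H srcS'.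
  apply: (conclude w w' S) => // y yH yw yw'; apply: noS' => //.
  by apply: contraNN yw => /S'w ->.
have SS' b : b \in S -> (b == w') || (b \in S').
  by move=> /SR'; rewrite negb_and !negbK orbC.
have w'S : w' \in S.
  apply: contraR bad => w'S; have /predU1P[Dv|->] := SS' v vS.
    by rewrite -Dv vS in w'S.
  by rewrite andbT; apply: contraNneq w'S => <-.
have wS : w \notin S by apply/negP=> /SinH[]; rewrite eqxx.
have w'S' : w' \notin S' by apply/negP=> /S'inH[]; rewrite eqxx.
(* Otherwise [w' |: S'] is a source set of [H], which is strong. *)
have wS' : w \notin S'.
  apply/negP=> wS'.
  case: (no_source (w' |: S') w' r'); rewrite ?setU11 // ?inE ?negb_or ?r'w' //.
    by apply/subsetP=> y /setU1P[->//|/S'inH[]].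
  move=> x y xH; rewrite !inE negb_or => /andP[xw' xS'] /predU1P[->|]; last exact: noS'.
  apply: noS => //; first by apply: contraNneq xS' => ->.
  by apply/negP=> /SS'; rewrite (negPf xw') (negPf xS').
have Sw' y : y \in S -> y = w'.
  move=> yS; apply/eqP; apply: contraT => yw'.
  suff /(leS _ _ w'H) : source_set e (H :\ w') (S :\ w').
    by rewrite (cardsD1 w' S) w'S ltnn.
  apply/source_setP; split.
  - by apply/subsetP=> x /setD1P[xw' /SinH[_ xH]]; apply/setD1P.
  - by apply/set0Pn; exists y; apply/setD1P.
  - exists w; first by apply/setD1P; rewrite eq_sym.
    by rewrite inE (negPf wS) andbF.
  move=> x z /setD1P[xw' xH]; rewrite !inE xw' /= => xS /andP[zw' zS].
  have [Dx|xw] := eqVneq x w; last exact: noS.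
  by subst x; apply: noS' => //; have := SS' z zS; rewrite (negPf zw').
apply: (conclude w' w S') => //; first by rewrite -(Sw' v vS).
by move=> y yH yw' yw; apply: noS => //; apply: contraNN yw' => /Sw' ->.
Qed.
End GoodContraction.
End Local.

(** * Many vertices of small indegree and outdegree *)

(** Double counting: the in-neighbourhoods of [X], of size at most two, cover [A];
    if [A] is as large as possible, no vertex is covered twice. *)
Lemma cover_by_pairs (T : finType) (A X : {set T}) (r : rel T) :
    (forall x, x \in X -> #|[set u in A | r u x]| <= 2) ->
    (forall u, u \in A -> exists2 x, x \in X & r u x) ->
  #|A| <= 2 * #|X| /\
  (#|A| = 2 * #|X| -> forall u x x', u \in A -> x \in X -> x' \in X ->
     r u x -> r u x' -> x = x').
Proof.
move=> le2 cov.
have: \sum_(u in A) #|[set x in X | r u x]| <= 2 * #|X|.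
  rewrite (eq_bigr (fun u => \sum_(x in X) r u x)); last first.
    by move=> u _; rewrite cardsE -sum1_card big_mkcondr; apply: eq_bigr => x _; case: (r u x).
  rewrite exchange_big /= mulnC -sum_nat_const; apply: leq_sum => x /le2.
  rewrite cardsE -sum1_card big_mkcondr /=; apply: leq_trans.
  by apply: leq_sum => u _; case: (r u x).
have pos u : u \in A -> 0 < #|[set x in X | r u x]|.
  by move=> /cov[x xX ux]; apply/card_gt0P; exists x; rewrite inE xX.
move=> le; split=> [|eqA u x x' uA xX x'X ux ux'].
  by apply: leq_trans le; rewrite -sum1_card; apply: leq_sum.
apply/eqP; apply: contraT => xx'.
suff : #|A| < 2 * #|X| by rewrite eqA ltnn.
apply: leq_trans le; rewrite -sum1_card (bigD1 u) //= (bigD1 u uA) /= -addSn.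
apply: leq_add; last by apply: leq_sum => v /andP[/pos].
have <- : #|[set x; x']| = 2 by rewrite cards2 xx'.
by apply/subset_leq_card/subsetP=> y; rewrite !inE => /orP[] /eqP->; apply/andP.
Qed.

Section Count.
Variables (T : finType) (e : rel T) (A : {set T}).
Hypotheses (scA : semicomplete_on e A).

(** Let [X] and [Y] be the vertices of indegree at most two and those of outdegree at most
    two. With six vertices or more they are disjoint, and each has at least half of the vertices by
    [cover_by_pairs]. So they partition [A], every vertex has just one out-neighbour in
    [X] and just one in-neighbour in [Y], and the arcs from [Y] to [X] are a perfect
    matching; all other pairs are joined from [X] to [Y]. Take a matched pair [u -> x]
    and a source set [S] left by deleting it. Following the matching, [S] contains some
    [y] in [Y] and its complement some [x'] in [X]. Since no arc enters [S], [y -> x'],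
    so they are matched; and any further vertex [m], on either side of [S], would give
    [y] or [x'] a second partner. *)
Lemma indegree2_card : 
    (forall u, u \in A -> exists2 x, x \in A :\ u &
       [/\ e u x, #|in_nbrs e A x| <= 2 & ~ strong_on e (A :\ u :\ x)]) ->
    (forall u, u \in A -> exists2 y, y \in A :\ u &
       e y u /\ #|in_nbrs (rev_rel e) A y| <= 2) ->
  #|A| <= 5.
Proof.
move=> hX hY; rewrite leqNgt; apply/negP=> A_gt5.
pose X := [set x in A | #|in_nbrs e A x| <= 2].
pose Y := [set y in A | #|in_nbrs (rev_rel e) A y| <= 2].
have disj a : a \in X -> a \in Y -> False.
  rewrite !inE => /andP[aA in2] /andP[_ out2].
  have : A :\ a \subset in_nbrs e A a :|: in_nbrs (rev_rel e) A a.
    apply/subsetP=> b /[dup] bAa /setD1P[ba bA].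
    by rewrite !inE ba bA /=; apply: scA.
  move/subset_leq_card; move: A_gt5; rewrite (cardsD1 a) aA => gt5.
  by have [] := leq_card_setU (in_nbrs e A a) (in_nbrs (rev_rel e) A a); lia.
have [||leX uX] := @cover_by_pairs T A X (fun u x => (u != x) && e u x).
- move=> x; rewrite inE => /andP[xA]; apply: leq_trans; apply/subset_leq_card/subsetP=> u.
  by rewrite !inE => /and3P[-> -> ->].
- move=> u uA; have [x /setD1P[xu xA] [ux in2 _]] := hX u uA.
  by exists x; rewrite ?inE ?xA // eq_sym xu.
have [||leY uY] := @cover_by_pairs T A Y (fun u y => (u != y) && e y u).
- move=> y; rewrite inE => /andP[yA]; apply: leq_trans; apply/subset_leq_card/subsetP=> u.
  by rewrite !inE => /and3P[-> -> ?].
- move=> u uA; have [y /setD1P[yu yA] [uy out2]] := hY u uA.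
  by exists y; rewrite ?inE ?yA // eq_sym yu.
have XA : X \subset A by apply/subsetP=> x; rewrite inE => /andP[].
have YA : Y \subset A by apply/subsetP=> x; rewrite inE => /andP[].
have XYA : X :|: Y \subset A by rewrite subUset XA.
have cardXY : #|X :|: Y| = #|X| + #|Y|.
  rewrite cardsU; have -> : X :&: Y = set0; last by rewrite cards0 subn0.
  by apply/setP=> a; rewrite in_set0; apply/negP=> /setIP[]; apply: disj.
have le_card := subset_leq_card XYA.
have {}uX := uX ltac:(lia); have {}uY := uY ltac:(lia).
have part a : a \in A -> (a \in X) || (a \in Y).
  have /eqP DA : X :|: Y == A by rewrite eqEcard XYA; lia.
  by rewrite -[in a \in _]DA inE.
have [u uY'] : exists u, u \in Y by apply/set0Pn; rewrite -card_gt0; lia.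
have uA := subsetP YA u uY'.
have [x /setD1P[xu xA] [ux xin2 nst]] := hX u uA.
have xX : x \in X by rewrite inE xA.
apply: nst => S; apply/negP=> /source_setP[SM /set0Pn[s sS] [t tM tS] noS].
have inM a : a \in A :\ u :\ x -> [/\ a != x, a != u & a \in A].
  by move=> /setD1P[ax /setD1P[]].
have inS a : a \in S -> [/\ a != x, a != u & a \in A] by move/(subsetP SM)/inM.
have MS a : a != x -> a != u -> a \in A -> a \in A :\ u :\ x.
  by rewrite !inE => -> ->.
have outY y : y \in Y -> y \in A :\ u :\ x ->
    exists x', [/\ x' \in X, x' \in A :\ u :\ x, x' != y & e y x'].
  move=> yY /inM[yx yu yA]; have [x' /setD1P[x'y x'A] [yx' x'in2 _]] := hX y yA.
  have x'X : x' \in X by rewrite inE x'A.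
  exists x'; split=> //; apply: MS => //.
    apply: contraNneq yu => Dx'; subst x'.
    by apply/eqP; apply: (uY x y u); rewrite ?yx' ?ux ?andbT // eq_sym.
  by apply/eqP=> Dx'; subst x'; apply: (disj u).
have inX x' : x' \in X -> x' \in A :\ u :\ x ->
    exists y, [/\ y \in Y, y \in A :\ u :\ x, x' != y & e y x'].
  move=> x'X /inM[x'x x'u x'A]; have [y /setD1P[yx' yA] [yx'arc out2]] := hY x' x'A.
  have yY : y \in Y by rewrite inE yA.
  exists y; split=> //; last by rewrite eq_sym.
  apply: MS => //; first by apply/eqP=> Dy; subst y; apply: (disj x).
  apply: contraNneq x'x => Dy; subst y.
  by apply/eqP; apply: (uX u x' x); rewrite ?yx'arc ?ux ?andbT // eq_sym.
have inXS x' : x' \in S -> x' \in X -> exists y, [/\ y \in Y, y \in S, y != x' & e y x'].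
  move=> x'S x'X; have [y [yY yM nyx' yx']] := inX x' x'X (subsetP SM x' x'S).
  exists y; split=> //; last by rewrite eq_sym.
  by apply: contraLR yx' => yS; apply: noS.
have outYR y : y \in A :\ u :\ x -> y \notin S -> y \in Y ->
    exists x', [/\ x' \in X, x' \in A :\ u :\ x, x' \notin S, y != x' & e y x'].
  move=> yM yS yY; have [x' [x'X x'M nyx' yx']] := outY y yY yM.
  exists x'; split=> //; last by rewrite eq_sym.
  by apply: contraL yx' => x'S; apply: noS.
have [y yS yY] : exists2 y, y \in S & y \in Y.
  have [_ _ /part/orP[sX|sY]] := inS s sS; last by exists s.
  by have [y [yY yS _ _]] := inXS s sS sX; exists y.
have [x' [x'X x'M x'S]] : exists x', [/\ x' \in X, x' \in A :\ u :\ x & x' \notin S].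
  have [_ _ /part/orP[tX|tY]] := inM t tM; first by exists t.
  by have [x' [x'X x'M x'S _]] := outYR t tM tS tY; exists x'.
have link b c : b \in S -> c \in A :\ u :\ x -> c \notin S -> (b != c) && e b c.
  move=> bS cM cS; have [_ _ bA] := inS b bS; have [_ _ cA] := inM c cM.
  have bc : b != c by apply: contraNneq cS => <-.
  by have := scA bA cA bc; rewrite bc (negPf (noS c b cM cS bS)) orbF.
(* Three vertices other than [u] and [x] are what the contradiction needs. *)
have [m mM /andP[my mx']] : exists2 m, m \in A :\ u :\ x & (m != y) && (m != x').
  have [m] : exists m, m \in A :\ u :\ x :\ y :\ x'.
    apply/set0Pn; rewrite -card_gt0; move: A_gt5.
    rewrite (cardsD1 u) (cardsD1 x (A :\ u)) (cardsD1 y (A :\ u :\ x)).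
    by rewrite (cardsD1 x' (_ :\ y)); case: #|_| => //; do !case: (_ \in _).
  by move=> /setD1P[mx' /setD1P[my mM]]; exists m; rewrite ?my.
have [_ _ mA] := inM m mM; have [_ _ yA] := inS y yS; have [_ _ x'A] := inM x' x'M.
have yx' := link y x' yS x'M x'S.
have uY'' y' : y' \in Y -> (y' != x') && e y' x' -> y' = y.
  by move=> y'Y ?; apply: (uY x' y' y) => //; rewrite eq_sym.
have uX'' x'' : x'' \in X -> (y != x'') && e y x'' -> x'' = x'.
  by move=> x''X ?; apply: (uX y x'' x').
have [mS|mS] := boolP (m \in S); have /orP[mX|mY] := part m mA.
- have [y' [y'Y y'S ny'm y'm]] := inXS m mS mX.
  have Dy' := uY'' y' y'Y (link y' x' y'S x'M x'S); subst y'.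
  by rewrite (uX'' m mX) ?eqxx ?ny'm in mx'.
- by rewrite (uY'' m mY (link m x' mS x'M x'S)) eqxx in my.
- by rewrite (uX'' m mX (link y m yS mM mS)) eqxx in mx'.
have [x'' [x''X x''M x''S nmx'' mx'']] := outYR m mM mS mY.
have Dx'' := uX'' x'' x''X (link y x'' yS x''M x''S); subst x''.
by rewrite (uY'' m mY) ?eqxx ?nmx'' in my.
Qed.

End Count.

(** * Exhaustive search *)

(** Row [i], column [j] holds the weight of the arc from [i] to [j], or [None] if
    it is absent or not yet decided. Reading past the end gives [None]. *)
Definition table := seq (seq (option bool)).

Definition entry (t : table) i j := nth None (nth [::] t i) j.

Definition set_entry (t : table) i j s : table :=
  set_nth [::] t i (set_nth None (nth [::] t i) j s).

Lemma entry_set t i j s k l :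
  entry (set_entry t i j s) k l = if (k == i) && (l == j) then s else entry t k l.
Proof.
rewrite /entry /set_entry nth_set_nth /=.
by have [->|] := eqVneq k i; rewrite //= nth_set_nth.
Qed.

(** Unlike [has], this stops at the first success under call-by-value evaluation,
    where both arguments of [||] are computed. *)
Fixpoint any (X : Type) (P : pred X) s :=
  if s is x :: s' then if P x then true else any P s' else false.

Lemma anyE (X : Type) (P : pred X) s : any P s = has P s.
Proof. by elim: s => //= x s ->. Qed.

Implicit Types f g a : nat -> nat -> option bool.

Fixpoint walk_parity f x p : option bool :=
  if p is y :: q then
    if f x y is Some b then omap (addb b) (walk_parity f y q) else None
  else Some false.

Definition even_cycle f (c : seq nat) :=
  if c is x :: p then walk_parity f x (rcons p x) == Some false else false.

(** The states of a pair [i < j] in a semicomplete digraph in which the two arcs of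
    a digon have different weights. At vertex 0 the weights are normalised by
    switching, which halves the number of states. *)
Definition pair_states i : seq (option bool * option bool) :=
  let even := Some false in let odd := Some true in
  if i == 0 then [:: (even, None); (None, even); (even, odd)]
  else [:: (even, None); (odd, None); (None, even); (None, odd);
           (even, odd); (odd, even)].

(** An agenda entry [(i, j, cs)] asks to decide the pair [i], [j] in all ways and then
    to prune if one of the closed words [cs] has become an even cycle. *)
Fixpoint search (leaf : table -> bool) ps t :=
  if ps is (i, j, cs) :: ps' then
    all (fun st => let t' := set_entry (set_entry t i j st.1) j i st.2 in
           if any (even_cycle (entry t')) cs then true else search leaf ps' t')
        (pair_states i)
  else leaf t.

Definition sub_table f g := forall k l b, f k l = Some b -> g k l = Some b.

Lemma sub_even_cycle f g c : sub_table f g -> even_cycle f c -> even_cycle g c.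
Proof.
move=> fg; case: c => //= x p; suff walk_fg q y b :
    walk_parity f y q = Some b -> walk_parity g y q = Some b.
  by move/eqP/walk_fg->.
elim: q y b => //= z q IHq y b; case Df: (f y z) => [c|//]; rewrite (fg _ _ _ Df).
by case Dq: (walk_parity f z q) => [d|//]; rewrite (IHq _ _ Dq).
Qed.

Lemma sub_set_entry t a i j :
  sub_table (entry t) a -> sub_table (entry (set_entry t i j (a i j))) a.
Proof.
by move=> ta k l b; rewrite entry_set; case: andP => [[/eqP-> /eqP->]|_ /ta].
Qed.

(** The branch of the search tree that follows [a] is never pruned, since even
    cycles of a partial table persist in [a]; it ends in a leaf that agrees with [a]
    on all pairs of the agenda. *)
Lemma search_sound leaf ps t a : search leaf ps t ->
    (forall i j cs, (i, j, cs) \in ps -> (a i j, a j i) \in pair_states i /\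
        {in cs, forall c, ~~ even_cycle a c}) ->
    sub_table (entry t) a ->
  exists t', [/\ leaf t', forall k l, entry t k l = a k l -> entry t' k l = a k l &
    forall i j cs, (i, j, cs) \in ps -> entry t' i j = a i j /\ entry t' j i = a j i].
Proof.
elim: ps t => [|[[i j] cs] ps IHps] t /= leaf_t okps ta; first by exists t.
have [sta noc] := okps i j cs (mem_head _ _).
pose t1 := set_entry (set_entry t i j (a i j)) j i (a j i).
have t1a : sub_table (entry t1) a by do 2!apply: sub_set_entry.
have := allP leaf_t _ sta; rewrite -/t1 anyE; case: ifP => [/hasP[c cs_c] | _ leaf_t1].
  by move/(sub_even_cycle t1a); rewrite (negPf (noc c cs_c)).
have [|t' [leaf_t' t1t' t'ps]] := IHps t1 leaf_t1 _ t1a.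
  by move=> i1 j1 cs1 ps1; apply: okps; rewrite inE ps1 orbT.
have t1E k l : entry t k l = a k l \/ (k, l) \in [:: (i, j); (j, i)] ->
    entry t1 k l = a k l.
  rewrite !entry_set !inE !xpair_eqE.
  have [/andP[/eqP-> /eqP->]|_] := boolP ((k == j) && (l == i)); first by [].
  have [/andP[/eqP-> /eqP->]|_] := boolP ((k == i) && (l == j)); first by [].
  by case.
exists t'; split=> // [k l tkl|i1 j1 cs1]; first by apply/t1t'/t1E; left.
rewrite inE => /predU1P[[-> -> _]|/t'ps//].
by split; apply/t1t'/t1E; right; rewrite !inE eqxx ?orbT.
Qed.

Fixpoint subsequences (s : seq nat) : seq (seq nat) :=
  if s is x :: s' then
    let r := subsequences s' in map (cons x) r ++ r
  else [:: [::]].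

(** The cycles with largest vertex [j] that use the pair [i], [j]. Those with a pair
    that is decided later are harmless, an undecided arc being read as absent. *)
Definition last_cycles i j :=
  [seq j :: p | p <- flatten [seq permutations s | s <- subsequences (iota 0 j)]
              & (p != [::]) && ((head j p == i) || (last j p == i))].

Definition agenda n := [seq (i, j, last_cycles i j) | j <- iota 0 n, i <- iota 0 j].

(** The triples [(x, r, s)] in which [r] and [s] split the vertices other than [x];
    if no arc goes from [r] to [s], deleting [x] destroys strength. *)
Definition all_cuts n :=
  [seq (x, R, filter (predC (mem R)) (rem x (iota 0 n))) |
    x <- iota 0 n, R <- [seq s <- subsequences (rem x (iota 0 n)) | 0 < size s < n.-1]].

Definition is_cut f (xrs : nat * seq nat * seq nat) :=
  let: (_, r, s) := xrs in
  ~~ any (fun k => any (fun l => f k l != None) s) r.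

Definition W4_arc_nat i j :=
  (i, j) \in [:: (0, 1); (1, 2); (2, 3); (3, 0); (0, 2); (2, 0); (1, 3); (3, 1)].

Definition is_W4_along f (p : seq nat) :=
  all (fun i => all (fun j =>
    (i == j) || ((f i j != None) == W4_arc_nat (nth 0 p i) (nth 0 p j))) (iota 0 4)) (iota 0 4).

Definition leaf_test n cuts orders t :=
  if any (is_cut (entry t)) cuts then true
  else if n == 4 then has (is_W4_along (entry t)) orders else false.

Definition small_search n :=
  let orders := permutations (iota 0 4) in
  let cuts := all_cuts n in
  search (leaf_test n cuts orders) (agenda n) [::].

(** That the lists enumerated above consist of cycles and of bipartitions is itself
    checked by evaluation. *)
Definition valid_agenda n :=
  all (fun ijc => all (fun c => [&& uniq c, all (fun x => x < n) c & 1 < size c]) ijc.2)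
      (agenda n).

Definition valid_cuts n :=
  all (fun xRS => let: (x, r, s) := xRS in
    [&& r != [::], s != [::] & perm_eq (x :: r ++ s) (iota 0 n)]) (all_cuts n).

(** For order 5 the search visits about 150000 partial tables. *)
Lemma small_search345 n : n \in [:: 3; 4; 5] ->
  [&& small_search n, valid_agenda n & valid_cuts n].
Proof. by rewrite !inE => /or3P[] /eqP->; vm_cast_no_check (erefl true). Qed.

(** * Orders three, four and five *)

Section SmallOrders.
Variables (T : finType) (e : rel T) (w : T -> T -> bool) (A : {set T}).
Hypotheses (scA : semicomplete_on e A) (cA : two_connected_on e A).
Hypothesis oA : odd_cycles e w A.
Variable x0 : T.
Let s := enum A.
Let n := size s.
Let v i := nth x0 s i.

(** Switching at the vertices of potential [true] makes the weight 0 on the arcs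
    leaving [v 0], and on the arcs entering it from vertices that it does not
    dominate. *)
Definition potential y := 
  if y == v 0 then false else if e (v 0) y then w (v 0) y else w y (v 0).

Definition norm_weight x y := w x y (+) (potential x (+) potential y).

Lemma odd_cycles_norm : odd_cycles e norm_weight A.
Proof.
move=> x p p0 Up pA pe; rewrite parity_switch last_rcons addbb addbF.
exact: oA.
Qed.

Definition signed_arc i j := if e (v i) (v j) then Some (norm_weight (v i) (v j)) else None.

Lemma walk_signed_arc i p b : walk_parity signed_arc i p = Some b ->
  path e (v i) (map v p) /\ parity norm_weight (v i) (map v p) = b.
Proof.
elim: p i b => [|j p IHp] i b /=; first by case.
rewrite {1}/signed_arc; case: ifP => //= _.
by case Dp: walk_parity => [c|] //= [<-]; have [-> ->] := IHp _ _ Dp.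
Qed.

Lemma vA i : i < n -> v i \in A.
Proof. by move=> lti; rewrite -mem_enum mem_nth. Qed.

Lemma v_inj : {in gtn n &, injective v}.
Proof. by move=> i j lti ltj /eqP; rewrite nth_uniq ?enum_uniq // => /eqP. Qed.

Lemma no_even_cycle c :
  uniq c -> all (gtn n) c -> 1 < size c -> ~~ even_cycle signed_arc c.
Proof.
case: c => // i p Up ltp p_gt0; apply/negP=> /eqP/walk_signed_arc.
rewrite map_rcons => -[pe odd0].
have := @odd_cycles_norm (v i) (map v p); rewrite odd0; case/(_ _ _ _ pe)/notF.
- by case: (p) p_gt0.
- rewrite -map_cons map_inj_in_uniq // => j k /(allP ltp) ltj /(allP ltp) ltk.
  exact: v_inj.
- by move=> y; rewrite -map_cons => /mapP[j /(allP ltp) ltj ->]; apply: vA.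
Qed.

Lemma signed_arc_states i j : i < j < n ->
  (signed_arc i j, signed_arc j i) \in pair_states i.
Proof.
case/andP=> ltij ltjn; have ltin := ltn_trans ltij ltjn.
have neq_v : v i != v j.
  by apply: contraTneq ltij => /v_inj->; rewrite ?ltnn.
have two : e (v i) (v j) -> e (v j) (v i) ->
    norm_weight (v i) (v j) (+) norm_weight (v j) (v i).
  move=> eij eji; have := @odd_cycles_norm (v i) [:: v j].
  rewrite /= eij eji inE neq_v addbF; apply=> //.
  by move=> y; rewrite !inE => /orP[] /eqP->; apply: vA.
have w0 : i = 0 -> if e (v i) (v j) then norm_weight (v i) (v j) = false
                   else norm_weight (v j) (v i) = false.
  move=> i0; subst i; rewrite /norm_weight /potential eqxx eq_sym (negPf neq_v).
  by case: (e _ _); rewrite ?addbF addbb.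
have := scA (vA ltin) (vA ltjn) neq_v; rewrite /signed_arc /pair_states.
move: two w0; case: e => /=; case: e => //=.
- move=> /(_ isT isT) odd2 w0; case: eqP odd2 => [/w0->|_]; first by case: norm_weight.
  by do 2!case: norm_weight.
- by move=> _ w0 _; case: eqP => [/w0->|_] //; case: norm_weight.
- by move=> _ w0 _; case: eqP => [/w0->|_] //; case: norm_weight.
Qed.

Lemma small_order : 2 < #|A| <= 5 -> #|A| = 4 /\
  exists2 p, perm_eq p (iota 0 4) &
    forall i j, i < 4 -> j < 4 -> i != j ->
      e (v i) (v j) = W4_arc_nat (nth 0 p i) (nth 0 p j).
Proof.
rewrite [#|A|]cardE -/s -/n => n345.
have /small_search345/and3P[found okag okcuts] : n \in [:: 3; 4; 5].
  by case: n n345 => [|[|[|[|[|[|m]]]]]].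
have emptyE k l : entry [::] k l = None by rewrite /entry !nth_nil.
have [i j cs /allpairsPdep[j' [i' [jn ij [-> -> ->]]]]|k l b|t [leaf_t _ t_arc]] :=
  search_sound (a := signed_arc) found.
- rewrite !mem_iota /= add0n in jn ij.
  split=> [|c]; first by rewrite signed_arc_states ?ij.
  have /(allP okag)/allP okc : (i', j', last_cycles i' j') \in agenda n.
    by apply/allpairsPdep; exists j', i'; rewrite !mem_iota.
  by move/okc/and3P=> [Uc ltc szc]; apply: no_even_cycle.
- by rewrite emptyE.
have tE i j : i < n -> j < n -> i != j -> (entry t i j != None) = e (v i) (v j).
  have eqE k l : entry t k l = signed_arc k l -> (entry t k l != None) = e (v k) (v l).
    by move->; rewrite /signed_arc; case: (e _ _).
  move=> lti ltj; case: ltngtP => // [ij|ji] _; apply: eqE.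
    have ag : (i, j, last_cycles i j) \in agenda n.
      by apply/allpairsPdep; exists j, i; rewrite !mem_iota.
    by case: (t_arc _ _ _ ag).
  have ag : (j, i, last_cycles j i) \in agenda n.
    by apply/allpairsPdep; exists i, j; rewrite !mem_iota.
  by case: (t_arc _ _ _ ag).
move: leaf_t; rewrite /leaf_test anyE; case: ifP => [/hasP[[[x r] q]]|_].
  move/(allP okcuts)=> /and3P[r0 q0 rq] cut.
  (* The vertices listed in [q] form a source set once [v x] is deleted. *)
  have Uxrq : uniq (x :: r ++ q) by rewrite (perm_uniq rq) iota_uniq.
  have xrqE y : (y \in x :: r ++ q) = (y < n) by rewrite (perm_mem rq) mem_iota.
  have ltx : x < n by rewrite -xrqE mem_head.
  have ltr y : y \in r -> y < n by move=> yr; rewrite -xrqE inE mem_cat yr orbT.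
  have ltq y : y \in q -> y < n by move=> yq; rewrite -xrqE inE mem_cat yq !orbT.
  have neq_xrq y z : y \in r -> z \in q -> [/\ y != x, z != x & y != z].
    move: Uxrq; rewrite /= cat_uniq mem_cat negb_or => /andP[/andP[xr xq] /and3P[_ rq0 _]].
    move=> yr zq; split; first by apply: contraNneq xr => <-.
      by apply: contraNneq xq => <-.
    by apply: contraNneq rq0 => Dy; apply/hasP; exists z; rewrite // -Dy.
  have [y0 y0r] : exists y, y \in r by case: (r) r0 => // y *; exists y; rewrite mem_head.
  have [z0 z0q] : exists z, z \in q by case: (q) q0 => // z *; exists z; rewrite mem_head.
  case/negP: (cA (vA ltx) [set y in map v q]); apply/source_setP; split.
  - apply/subsetP=> y; rewrite inE => /mapP[z zq ->].
    have [_ zx _] := neq_xrq y0 z y0r zq; apply/setD1P; split; last exact/vA/ltq.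
    by apply: contraNneq zx => /v_inj->; rewrite // ?inE ?ltx ?ltq.
  - by apply/set0Pn; exists (v z0); rewrite inE map_f.
  - have [yx _ _] := neq_xrq y0 z0 y0r z0q.
    exists (v y0); first apply/setD1P.
      split; last exact/vA/ltr.
      by apply: contraNneq yx => /v_inj->; rewrite // ?inE ?ltx ?ltr.
    rewrite inE; apply/mapP=> -[z zq Dz]; have [_ _ /eqP[]] := neq_xrq y0 z y0r zq.
    by apply: v_inj Dz; [apply: ltr | apply: ltq].
  move=> a b /setD1P[ax aA] aq; rewrite inE => /mapP[l lq Db]; subst b.
  have [k ltk Da] : exists2 k, k < n & a = v k.
    by exists (index a s); [rewrite /n index_mem mem_enum | rewrite /v nth_index ?mem_enum].
  subst a; have kr : k \in r.
    have : k \in x :: r ++ q by rewrite xrqE.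
    rewrite inE mem_cat => /or3P[/eqP Dk|//|kq]; first by rewrite Dk eqxx in ax.
    by rewrite inE map_f in aq.
  have [_ _ kl] := neq_xrq k l kr lq.
  rewrite -tE ?ltk ?ltq //; move: cut; rewrite /is_cut anyE => /hasPn/(_ k kr).
  by rewrite anyE => /hasPn/(_ l lq).
case: eqP => // n4 /hasP[p]; rewrite mem_permutations => p4 /allP W4p.
split=> //; exists p => // i j lti ltj ij.
have := W4p i; rewrite mem_iota => /(_ lti)/allP/(_ j); rewrite mem_iota => /(_ ltj).
by rewrite (negPf ij) tE ?n4 // => /eqP.
Qed.
End SmallOrders.

(** * The descent *)

(** A counterexample of order at least six gives one that is smaller by one, by
    contraction in the digraph or in its reverse; the exception of
    [contract_or_indegree2] cannot hold at all vertices and in both directions by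
    [indegree2_card]. Order five is excluded by the search. *)
Lemma order_le4 (T : finType) (e : rel T) (w : T -> T -> bool) (A : {set T}) :
  semicomplete_on e A -> two_connected_on e A -> odd_cycles e w A -> #|A| <= 4.
Proof.
have [n] := ubnP #|A|; elim: n => // n IHn in e w A *.
rewrite ltnS => leAn scA cA oA; have [A_gt4|//] := ltnP 4 #|A|.
have small (e1 : rel T) w1 u v : #|A| > 5 -> u \in A -> v \in A :\ u -> e1 u v ->
    semicomplete_on e1 A -> odd_cycles e1 w1 A ->
    ~ two_connected_on (contract_arc e1 u v) (A :\ u).
  move=> A_gt5 uA /setD1P[vu vA] uv sc1 o1 c1.
  move: A_gt5 leAn; rewrite (cardsD1 u) uA => gt5 le_n.
  suff le4 : #|A :\ u| <= 4 by rewrite add1n ltnS ltnNge le4 in gt5.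
  apply: IHn c1 _ => //; first exact: contract_semicomplete.
  exact: contract_odd_cycles o1.
have [A_gt5|A_le5] := ltnP 5 #|A|; last first.
  have [x0 _] : exists x, x \in A by apply/set0Pn; rewrite -card_gt0; case: #|_| A_gt4.
  have [|A4 _] := small_order scA cA oA x0; first by rewrite A_le5 (leq_trans _ A_gt4).
  by rewrite A4 in A_gt4.
have A_gt2 : 2 < #|A| by apply: leq_trans _ A_gt5.
have scR := semicomplete_on_rev scA; have cR := two_connected_on_rev cA.
have oR := odd_cycles_rev oA.
suff : #|A| <= 5 by rewrite leqNgt A_gt5.
apply: (indegree2_card scA) => u uA.
  have [[v vAu [uv c2]]|//] := contract_or_indegree2 scA cA uA A_gt2.
  by case: (small e w u v).
have [[v vAu [uv c2]]|[x xAu [ux in2 _]]] := contract_or_indegree2 scR cR uA A_gt2.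
  by case: (small (rev_rel e) (rev_rel w) u v).
by exists x.

Qed.

Theorem theorem5p1 (D : digraph) :
  two_connected D -> semicomplete D -> noneven D -> isomorphic D W4.
Proof.
move=> [D_gt2 cD] sD [w oD].
have scT : semicomplete_on (@Defs.arc D) setT by move=> x y _ _; apply: sD.
have cT : two_connected_on (@Defs.arc D) setT.
  move=> x _ S; apply/negP=> /source_setP[SV /set0Pn[s sS] [r /setD1P[rx _] rS] noS].
  have sx : s \notin [set x] by have /setD1P[] := subsetP SV s sS; rewrite inE.
  have rx' : r \notin [set x] by rewrite inE.
  have /(cD [set x])/(_ (exist _ r rx') (exist _ s sx)) : #|[set x]| <= 1 by rewrite cards1.
  (* A path from [r] outside the source set to [s] inside would have to enter it. *)
  case/connectP=> p; elim: p r rx' rx rS => [|[z zx] p IHp] r rx' rx rS /=.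
    by move=> _ [Ds]; rewrite Ds (negPf rS) in sS.
  move=> /andP[rz pz]; apply: (IHp z zx) => //; first by move: (zx); rewrite inE.
  apply: contraL rz => zS; apply: noS => //.
  by rewrite !inE rx.
have oT : odd_cycles (@Defs.arc D) w setT.
  move=> x p _ Up _ pe; rewrite -cycle_weight_parity //.
  by apply: oD; rewrite /dicycle /ucycleb /= pe.
have [x0 _] : exists x : D, x \in D by apply/card_gt0P; case: #|D| D_gt2.
have cardT := cardsT D.
have [|D4 [p p4 pE]] := small_order scT cT oT x0.
  by rewrite cardT D_gt2 (leq_trans _ (leqnSn 4)) // -cardT (order_le4 scT cT oT).
pose k d := index d (enum [set: D]).
have ltk d : k d < 4 by rewrite -D4 cardE index_mem mem_enum inE.
have kK d : nth x0 (enum [set: D]) (k d) = d by rewrite nth_index ?mem_enum ?inE.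
have ltp i : i < 4 -> nth 0 p i < 4.
  move=> lti; have : nth 0 p i \in p by rewrite mem_nth ?(perm_size p4).
  by rewrite (perm_mem p4) mem_iota.
pose f (d : D) : W4 := inord (nth 0 p (k d)).
have fE d : f d = nth 0 p (k d) :> nat by rewrite inordK ?ltp.
have f_inj : injective f.
  move=> d d' /(congr1 (@nat_of_ord 4)); rewrite !fE => /eqP.
  rewrite nth_uniq ?(perm_uniq p4) ?(perm_size p4) ?ltk // => /eqP Dk.
  by rewrite -(kK d) Dk kK.
exists f; first by apply: inj_card_bij => //; rewrite card_ord -cardT D4.
move=> d d'; have [<-|dd'] := eqVneq d d'; first by rewrite !arc_irrefl.
rewrite -{2}(kK d) -{2}(kK d') pE ?ltk //=; last first.
  by apply: contraNneq dd' => Dk; rewrite -(kK d) Dk kK.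
by rewrite /W4_arc !fE.
Qed.
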